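(* $4$-equivalence implies wink-equivalence: if two classical diagrams are $4$-equivalent, then they are wink-equivalent.
   Context: **Diagrams.** A virtual diagram (or simply diagram) is the image of a proper smooth immersion of a $1$-manifold (a disjoint union of finitely many circles and intervals) into a disk, whose singularities are transverse double points, each labelled as a classical crossing (with over/under information) or a virtual crossing. Proper means that the boundary of the $1$-manifold is mapped to the boundary of the disk. Diagrams are unoriented. A diagram is classical if it has no virtual crossings. **$4$-equivalence.** A $4$-move is the local move replacing two consecutive classical crossings of two strands (two half-twists of the same handedness, i.e. the two-strand braid $\sigma^2$) by the two opposite crossings (i.e. $\sigma^{-2}$). $4$-equivalence is the equivalence relation generated by $4$-moves and ambient isotopies of the links/tangles represented (on classical diagrams: planar isotopies fixing the boundary and classical Reidemeister moves). **Welded isotopy.** The equivalence relation on diagrams generated by ambient isotopies of the disk fixing the boundary pointwise and the local moves: classical Reidemeister moves I, II, III; virtual Reidemeister moves I, II, III (the same moves with all crossings virtual); the mixed Reidemeister move (a strand meeting two other strands only in virtual crossings may be moved across a classical crossing of these two strands); the (OC)-move (a strand passing over two other strands, via two classical crossings, may be moved across a virtual crossing of these two strands). **Wink-move.** In a disk with boundary points TL, BL (left) and TR, BR (right), let $\ell$ be an arc joining TL to BL and bulging to the right, and $r$ an arc joining TR to BR and bulging to the left, so that $\ell$ and $r$ meet in exactly two points, an upper one and a lower one, bounding a bigon. One of these two points is a virtual crossing, and the other is a classical crossing at which $r$ passes over $\ell$ (two possibilities, according to whether the classical crossing is the upper or the lower one). Call this configuration $K$. Let $cK$ be the configuration obtained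 by inserting on the left of $K$ one classical crossing $c$ (of either of the two types) between the two left ends of $\ell$, so that $\ell$ acquires one self-crossing. The wink-moves are the local moves $cK \leftrightarrow K$ (up to planar isotopy and rotation). All versions generate, with welded isotopy, the same equivalence relation. Wink-equivalence is the equivalence relation on diagrams generated by welded isotopy and wink-moves. *)

(* Defs.v *)
(* The disk is a rectangle with m marked points on its bottom side and n on its
   top side. A diagram in general position with respect to the height function
   is cut by horizontal lines into slices, each containing exactly one local
   minimum, local maximum or crossing next to vertical strands. It is the word
   of its slices, read from bottom to top.

   Ambient isotopy of the disk is generated by the codimension-one events of
   this slicing (constructors of [isotopy]): two events exchange heights, a
   minimum-maximum pair is born or dies, or one branch of a crossing becomes
   horizontal (an extremum passes through the crossing). This is the standard
   presentation of planar isotopy for sliced tangle diagrams (Freyd-Yetter,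
   Turaev; Kassel, Quantum Groups, Ch. X and XII). In its presence a local move
   drawn in one position can be performed in every rotated position, by bending
   the ends of the local picture with minima and maxima. *)
From Stdlib Require Export Relation_Operators.
From mathcomp Require Export all_boot.
Set Implicit Arguments.
Unset Strict Implicit.
Unset Printing Implicit Defensive.

(* Over-information refers to the bottom of a crossing: in [Classical true] the
   strand entering at the bottom left is the over-strand, in [Classical false]
   the strand entering at the bottom right. Diagrams are unoriented. *)
Inductive crossing := Classical of bool | Virtual.

Definition flip (x : crossing) : crossing :=
  if x is Classical b then Classical (~~ b) else Virtual.

(* [Cup] is a local minimum, [Cap] a local maximum. *)
Inductive piece := Cup | Cap | Cross of crossing.

Definition inputs (p : piece) : nat := if p is Cup then 0 else 2.
Definition outputs (p : piece) : nat := if p is Cap then 0 else 2.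

(* [(i, p)] is the piece p with i vertical strands on its left; the number of
   vertical strands on its right is determined by the number of strands below. *)
Definition slice := (nat * piece)%type.

(* Number of strands at the top of the word w placed above k strands; [None] if
   some slice of w does not fit. *)
Fixpoint top (k : nat) (w : seq slice) : option nat :=
  if w is (i, p) :: w' then
    if i + inputs p <= k then top (k - inputs p + outputs p) w' else None
  else Some k.

Record diagram (m n : nat) := Diagram {
  word :> seq slice;
  _ : top m word = Some n
}.

Definition is_virtual (s : slice) : bool :=
  if s.2 is Cross Virtual then true else false.

Definition classical (m n : nat) (D : diagram m n) : Prop :=
  ~~ has is_virtual D.

(* A local move [M k P Q] relates two local pictures P and Q, both placed above
   k strands. *)
Definition local_move := nat -> seq slice -> seq slice -> Prop.

Definition move_union (M N : local_move) : local_move :=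
  fun k P Q => M k P Q \/ N k P Q.

Definition shift (i : nat) (w : seq slice) : seq slice :=
  [seq (i + s.1, s.2) | s <- w].

(* D and D' agree outside a subrectangle, in which they are P and Q. *)
Inductive step (M : local_move) (m n : nat) (D D' : diagram m n) : Prop :=
  Step (below above P Q : seq slice) (i k l : nat) of
    M k P Q & top m below = Some l & i + k <= l &
    word D = below ++ shift i P ++ above &
    word D' = below ++ shift i Q ++ above.

Definition generated (M : local_move) (m n : nat) :
    diagram m n -> diagram m n -> Prop :=
  clos_refl_sym_trans (diagram m n) (@step M m n).

Inductive isotopy : local_move :=
| exchange (p q : piece) (d : nat) :
    isotopy (inputs p + d + inputs q)
      [:: (0, p); (outputs p + d, q)] [:: (inputs p + d, q); (0, p)]
| zigzag_right : isotopy 1 [:: (1, Cup); (0, Cap)] [::]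
| zigzag_left : isotopy 1 [:: (0, Cup); (1, Cap)] [::]
| slide_cap (x : crossing) :
    isotopy 3 [:: (0, Cross x); (1, Cap)] [:: (1, Cross (flip x)); (0, Cap)]
| slide_cup (x : crossing) :
    isotopy 1 [:: (0, Cup); (1, Cross x)] [:: (1, Cup); (0, Cross (flip x))].

Definition kink_right (x : crossing) : seq slice :=
  [:: (1, Cup); (0, Cross x); (1, Cap)].

Definition kink_left (x : crossing) : seq slice :=
  [:: (0, Cup); (1, Cross x); (0, Cap)].

(* Three strands, numbered from left to right at the bottom and crossing
   pairwise once: x is the crossing of strands 1 and 2, y of 1 and 3, z of 2
   and 3. [triangle_l] and [triangle_r] are the two ways of arranging these
   crossings. In both, at each crossing the strand with the smaller number
   enters at the bottom left. *)
Definition triangle_l (x y z : crossing) : seq slice :=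
  [:: (0, Cross x); (1, Cross y); (0, Cross z)].

Definition triangle_r (x y z : crossing) : seq slice :=
  [:: (1, Cross z); (0, Cross y); (1, Cross x)].

(* In R3, b1 = b2 says that strand 1 is above both or below both other strands,
   and b2 = b3 says the same of strand 3. The excluded cases b1 <> b2 <> b3 are
   those where the over-relation is cyclic. *)
Inductive reidemeister : local_move :=
| R1_right b : reidemeister 1 (kink_right (Classical b)) [::]
| R1_left b : reidemeister 1 (kink_left (Classical b)) [::]
| R2 b : reidemeister 2
    [:: (0, Cross (Classical b)); (0, Cross (Classical (~~ b)))] [::]
| R3 b1 b2 b3 of (b1 == b2) || (b2 == b3) : reidemeister 3
    (triangle_l (Classical b1) (Classical b2) (Classical b3))
    (triangle_r (Classical b1) (Classical b2) (Classical b3)).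

Inductive virtual_reidemeister : local_move :=
| VR1_right : virtual_reidemeister 1 (kink_right Virtual) [::]
| VR1_left : virtual_reidemeister 1 (kink_left Virtual) [::]
| VR2 : virtual_reidemeister 2 [:: (0, Cross Virtual); (0, Cross Virtual)] [::]
| VR3 : virtual_reidemeister 3
    (triangle_l Virtual Virtual Virtual) (triangle_r Virtual Virtual Virtual).

(* The index is the number of the moving strand. *)
Inductive mixed : local_move :=
| mixed1 b : mixed 3 (triangle_l Virtual Virtual (Classical b))
                     (triangle_r Virtual Virtual (Classical b))
| mixed2 b : mixed 3 (triangle_l Virtual (Classical b) Virtual)
                     (triangle_r Virtual (Classical b) Virtual)
| mixed3 b : mixed 3 (triangle_l (Classical b) Virtual Virtual)
                     (triangle_r (Classical b) Virtual Virtual).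

(* The index is the number of the strand passing over the two others. *)
Inductive over_commute : local_move :=
| OC1 : over_commute 3
    (triangle_l (Classical true) (Classical true) Virtual)
    (triangle_r (Classical true) (Classical true) Virtual)
| OC2 : over_commute 3
    (triangle_l (Classical false) Virtual (Classical true))
    (triangle_r (Classical false) Virtual (Classical true))
| OC3 : over_commute 3
    (triangle_l Virtual (Classical false) (Classical false))
    (triangle_r Virtual (Classical false) (Classical false)).

Inductive four : local_move :=
| four_move : four 2
    [:: (0, Cross (Classical true)); (0, Cross (Classical true))]
    [:: (0, Cross (Classical false)); (0, Cross (Classical false))].

(* The bigon K, with lower crossing x and upper crossing y: the arc l enters at
   BL (bottom left) and r at BR (bottom right), so that l is on the left below
   the crossing x and on the right below the crossing y. *)
Definition bigon (x y : crossing) : seq slice := [:: (0, Cross x); (0, Cross y)].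

(* The minimum and the maximum join the right ends of the crossing c to the
   left ends (BL and TL) of K; the left ends of c are the new left ends. *)
Definition crossed_bigon (c x y : crossing) : seq slice :=
  [:: (1, Cup); (0, Cross c)] ++ shift 2 (bigon x y) ++ [:: (1, Cap)].

Inductive wink : local_move :=
| wink_lower b : wink 2
    (crossed_bigon (Classical b) (Classical false) Virtual)
    (bigon (Classical false) Virtual)
| wink_upper b : wink 2
    (crossed_bigon (Classical b) Virtual (Classical true))
    (bigon Virtual (Classical true)).

Definition classical_isotopy_move : local_move := move_union isotopy reidemeister.

Definition welded_move : local_move :=
  move_union classical_isotopy_move
    (move_union virtual_reidemeister (move_union mixed over_commute)).

(* These moves do not change the number of virtual crossings, so from a
   classical diagram only classical diagrams are reached. *)
Definition four_equivalent (m n : nat) : diagram m n -> diagram m n -> Prop :=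
  @generated (move_union classical_isotopy_move four) m n.

Definition welded_isotopic (m n : nat) : diagram m n -> diagram m n -> Prop :=
  @generated welded_move m n.

Definition wink_equivalent (m n : nat) : diagram m n -> diagram m n -> Prop :=
  @generated (move_union welded_move wink) m n.

(* Main.v *)
(* In terms of Gauss diagrams, a classical crossing followed by a virtual one
   is an arrow from the over-strand r to the under-strand l, and a wink-move
   reverses the sign of this arrow at the cost of a self-crossing c of l. In a
   pair of crossings of l and r of the same sign, the arrows of c and of the
   two crossings form a triangle: a Reidemeister III move and an over-commute
   move make the two ends of c adjacent, and c disappears by Reidemeister I.
   Thus the sign of one crossing is reversed and the order of the ends is
   changed on one strand. Doing this once on each strand turns the two half
   twists into the two opposite ones. *)
Require Import Defs.
From mathcomp Require Import zify.
Set Implicit Arguments.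
Unset Strict Implicit.
Unset Printing Implicit Defensive.

(** * Strand counts of concatenated and shifted words *)

Lemma shift_cat i v w : shift i (v ++ w) = shift i v ++ shift i w.
Proof. exact: map_cat. Qed.

Lemma shift_shift i j w : shift i (shift j w) = shift (i + j) w.
Proof. by rewrite /shift -map_comp; apply: eq_map => s /=; rewrite addnA. Qed.

Lemma top_cat k v w : top k (v ++ w) = obind (fun l => top l w) (top k v).
Proof.
elim: v k => [|[i p] v IHv] k //=.
by case: ifP => // _; apply: IHv.
Qed.

Lemma top_shift k l i j w :
  top k w = Some l -> top (i + k + j) (shift i w) = Some (i + l + j).
Proof.
elim: w k => [|[h p] w IHw] k /=; first by case=> ->.
case: ifP => // hk /IHw {}IHw; rewrite ifT; last by lia.
by rewrite -IHw; congr top; lia.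
Qed.

Lemma top_local k l i n w :
  top k w = Some l -> i + k <= n -> top n (shift i w) = Some (n - k + l).
Proof.
move=> hw hn; have -> : n = i + k + (n - (i + k)) by lia.
by rewrite (top_shift _ _ hw); congr Some; lia.
Qed.

Definition wink_welded : local_move := move_union welded_move wink.

Lemma wink_welded_top k P Q :
  wink_welded k P Q -> exists2 l, top k P = Some l & top k Q = Some l.
Proof.
have ex p q d :
    top (inputs p + d + inputs q) [:: (0, p); (outputs p + d, q)]
      = Some (outputs p + d + outputs q) /\
    top (inputs p + d + inputs q) [:: (inputs p + d, q); (0, p)]
      = Some (outputs p + d + outputs q).
  by split=> /=; rewrite !ifT; try (congr Some); lia.
case=> [[[]|[|[]]]|] [].
(* Only the exchange has a symbolic number of strands; for all other moves [top] computes. *)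
- by move=> p q d; have [] := ex p q d; exists (outputs p + d + outputs q).
all: by intros; eexists; reflexivity.
Qed.

(** * Wink-equivalence of local words in every surrounding *)

Lemma diagram_inj m n (D D' : diagram m n) : word D = word D' -> D = D'.
Proof.
case: D D' => [w h] [w' h'] /= eq_w; case: w' / eq_w h' => h'.
by rewrite (eq_irrelevance h h').
Qed.

(** Quantifying over all surroundings lets local words be replaced inside larger words. The clause
    on [top] ensures that the middle word of a transitivity step is again the word of a diagram. *)
Definition equiv (k : nat) (P Q : seq slice) : Prop :=
  (forall i l, i + k <= l -> top l (shift i P) = top l (shift i Q)) /\
  (forall m n (D D' : diagram m n) below above i l,
    top m below = Some l -> i + k <= l ->
    word D = below ++ shift i P ++ above ->
    word D' = below ++ shift i Q ++ above -> wink_equivalent D D').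

Lemma equiv_refl k P : equiv k P P.
Proof.
split=> // m n D D' b a i l _ _ eqD eqD'.
by rewrite (@diagram_inj _ _ D D') ?eqD ?eqD' //; apply: rst_refl.
Qed.

Lemma equiv_sym k P Q : equiv k P Q -> equiv k Q P.
Proof.
case=> eq_top h; split=> [i l hl|m n D D' b a i l hb hl eqD eqD'].
  by rewrite eq_top.
by apply: rst_sym; apply: h hb hl eqD' eqD.
Qed.

Lemma equiv_trans k P Q R : equiv k P Q -> equiv k Q R -> equiv k P R.
Proof.
move=> [topPQ hPQ] [topQR hQR]; split=> [i l hl|m n D D' b a i l hb hl eqD eqD'].
  by rewrite topPQ ?topQR.
have hQ : top m (b ++ shift i Q ++ a) = Some n.
  by case: D eqD => w hw /= eqw; rewrite -hw eqw !top_cat hb /= !top_cat topPQ.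
apply: (@rst_trans _ _ _ (Diagram hQ)).
  by apply: hPQ hb hl eqD _.
by apply: hQR hb hl _ eqD'.
Qed.

Lemma equiv_move k P Q : wink_welded k P Q -> equiv k P Q.
Proof.
move=> hM; split=> [i l hl|m n D D' b a i l hb hl eqD eqD'].
  have [j hP hQ] := wink_welded_top hM.
  by rewrite (top_local hP) ?(top_local hQ).
by apply: rst_step; apply: Step hM hb hl eqD eqD'.
Qed.

Lemma equiv_context j k l i b a P Q :
  top j b = Some l -> i + k <= l -> equiv k P Q ->
  equiv j (b ++ shift i P ++ a) (b ++ shift i Q ++ a).
Proof.
move=> hb hl [eq_top h]; split=> [i' l' hl'|m n D D' b' a' i' l' hb' hl'].
  rewrite !shift_cat !shift_shift !top_cat (top_local hb) //= !top_cat.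
  by rewrite eq_top //; lia.
rewrite !shift_cat !shift_shift -!catA !(catA b').
apply: (h _ _ _ _ _ _ _ (l' - j + l)); last by lia.
by rewrite top_cat hb' /= (top_local hb).
Qed.

(* The b-th slice of v is the lowest one of P, which has i strands on its left. *)
Lemma equiv_at j k b i v w P Q :
  equiv k P Q ->
  (if top j (take b v) is Some l then i + k <= l else false) ->
  v = take b v ++ shift i P ++ drop (b + size P) v ->
  equiv j (take b v ++ shift i Q ++ drop (b + size P) v) w -> equiv j v w.
Proof.
move=> hPQ; case hb: (top j (take b v)) => [l|] // hl eqv; apply: equiv_trans.
by rewrite {1}eqv; apply: equiv_context hb hl hPQ.
Qed.

Lemma isotopy_equiv k P Q : isotopy k P Q -> equiv k P Q.
Proof. by move=> h; apply: equiv_move; left; left; left. Qed.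

Lemma reidemeister_equiv k P Q : reidemeister k P Q -> equiv k P Q.
Proof. by move=> h; apply: equiv_move; left; left; right. Qed.

Lemma virtual_equiv k P Q : virtual_reidemeister k P Q -> equiv k P Q.
Proof. by move=> h; apply: equiv_move; left; right; left. Qed.

Lemma over_commute_equiv k P Q : over_commute k P Q -> equiv k P Q.
Proof. by move=> h; apply: equiv_move; left; right; right; right. Qed.

Lemma wink_equiv k P Q : wink k P Q -> equiv k P Q.
Proof. by move=> h; apply: equiv_move; right. Qed.

Local Notation cup i := (i, Cup).
Local Notation cap i := (i, Cap).
Local Notation cross i x := (i, Cross x).
Local Notation over i := (cross i (Classical true)).
Local Notation under i := (cross i (Classical false)).
Local Notation virt i := (cross i Virtual).
Local Notation exch p q d := (isotopy_equiv (exchange p q d)).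
Local Notation cup_turn x := (isotopy_equiv (slide_cup x)).
Local Notation cap_turn x := (isotopy_equiv (slide_cap x)).
Local Notation rev h := (equiv_sym h).

(* The current word becomes [v] by applying [h] from slice [b] on, counted from 0, with [i] strands
   on the left. The side conditions hold by computation. *)
Tactic Notation "to" constr(v) "by" uconstr(h) "at" constr(b) constr(i) :=
  refine (@equiv_at _ _ b i _ _ _ _ h _ _ _);
  [reflexivity | reflexivity |
   match goal with |- equiv ?j _ ?w => change (equiv j v w) end].

(** * Wink-moves on three crossings of two strands *)

Lemma cap_R1 : equiv 2 [:: under 0; cap 0] [:: cap 0].
Proof.
(* The new minimum allows the crossing below the maximum to be brought to the form [kink_left]. *)
to [:: cup 1; cap 2; under 0; cap 0] by (rev (isotopy_equiv zigzag_left)) at 0 1.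
to [:: cup 1; under 0; cap 2; cap 0]
  by (rev (exch (Cross (Classical false)) Cap 0)) at 1 0.
to [:: cup 1; under 0; cap 0; cap 0] by (rev (exch Cap Cap 0)) at 2 0.
to [:: cup 0; over 1; cap 0; cap 0] by (rev (cup_turn (Classical true))) at 0 0.
to [:: cap 0] by (reidemeister_equiv (R1_left true)) at 0 0.
exact: equiv_refl.
Qed.

(* The over-strand of the first crossing becomes the loop of the wink-move. The
   two triangles are an R3 and an OC-move, in an order that depends on which of
   x and y is virtual. *)
Lemma clasp_wink x y :
  equiv 2 (crossed_bigon (Classical true) x y) (bigon x y) ->
  equiv 3 (triangle_l (Classical false) (flip x) (Classical true))
          (triangle_r (Classical false) (flip x) (Classical true)) ->
  equiv 3 (triangle_l y (Classical false) (Classical false))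
          (triangle_r y (Classical false) (Classical false)) ->
  equiv 2 [:: under 0; cross 0 x; cross 0 y]
          [:: cup 1; cross 0 (flip x); cross 1 y; under 2; cap 1].
Proof.
move=> hwink hlow hup.
(* The wink-move read backwards creates the self-crossing c, here [over 0]. *)
to [:: under 0; cup 1; over 0; cross 2 x; cross 2 y; cap 1] by (rev hwink) at 1 0.
to [:: under 0; cup 1; cross 2 x; over 0; cross 2 y; cap 1]
  by (exch (Cross (Classical true)) (Cross x) 0) at 2 0.
to [:: under 0; cup 2; cross 1 (flip x); over 0; cross 2 y; cap 1]
  by (cup_turn x) at 1 1.
to [:: cup 2; under 0; cross 1 (flip x); over 0; cross 2 y; cap 1]
  by (exch (Cross (Classical false)) Cup 0) at 0 0.
to [:: cup 2; over 1; cross 0 (flip x); under 1; cross 2 y; cap 1] by hlow at 1 0.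
to [:: cup 1; under 2; cross 0 (flip x); under 1; cross 2 y; cap 1]
  by (rev (cup_turn (Classical false))) at 0 1.
to [:: cup 1; cross 0 (flip x); under 2; under 1; cross 2 y; cap 1]
  by (rev (exch (Cross (flip x)) (Cross (Classical false)) 0)) at 1 0.
to [:: cup 1; cross 0 (flip x); cross 1 y; under 2; under 1; cap 1]
  by (rev hup) at 2 1.
(* The crossing [under 1] is c; its ends now meet at the maximum. *)
to [:: cup 1; cross 0 (flip x); cross 1 y; under 2; cap 1] by cap_R1 at 4 1.
exact: equiv_refl.
Qed.

Lemma clasp_wink_lower :
  equiv 2 [:: under 0; under 0; virt 0] [:: cup 1; over 0; virt 1; under 2; cap 1].
Proof.
apply: (clasp_wink (x := Classical false)).
- exact: wink_equiv (wink_lower true).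
- exact: reidemeister_equiv (R3 (b1 := false) (b2 := true) (b3 := true) isT).
- exact: over_commute_equiv OC3.
Qed.

Lemma clasp_wink_upper :
  equiv 2 [:: under 0; virt 0; over 0] [:: cup 1; virt 0; over 1; under 2; cap 1].
Proof.
apply: (clasp_wink (x := Virtual)).
- exact: wink_equiv (wink_upper true).
- exact: over_commute_equiv OC2.
- exact: reidemeister_equiv (R3 (b1 := true) (b2 := false) (b3 := false) isT).
Qed.

(** * Half turns of twists *)

Lemma nested_cups x : equiv 0 [:: cup 0; cup 1; cross 2 x] [:: cup 0; cup 1; cross 0 x].
Proof.
(* The crossing slides past both minima; it is flipped at each, so its type is restored. *)
to [:: cup 0; cup 2; cross 1 (flip x)] by (cup_turn x) at 1 1.
to [:: cup 0; cup 0; cross 1 (flip x)] by (exch Cup Cup 0) at 0 0.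
to [:: cup 0; cup 1; cross 0 (flip (flip x))] by (cup_turn (flip x)) at 1 0.
by case: x => [[]|]; apply: equiv_refl.
Qed.

Lemma nested_zigzag : equiv 2 [:: cup 0; cup 1; cap 3; cap 2] [::].
Proof.
to [:: cup 0; cap 1; cup 1; cap 2] by (exch Cup Cap 0) at 1 1.
to [:: cup 1; cap 2] by (isotopy_equiv zigzag_left) at 0 0.
to ([::] : seq slice) by (isotopy_equiv zigzag_left) at 0 1.
exact: equiv_refl.
Qed.

(** The crossings slide one by one around the nested minima to the left ends and then up past the
    maxima; the two parallel zigzags that remain are straightened. *)
Lemma half_turn x :
  equiv 2 [:: cup 0; cup 1; cross 2 x; cross 2 x; cap 3; cap 2]
          [:: cross 0 x; cross 0 x].
Proof.
to [:: cup 0; cup 1; cross 0 x; cross 2 x; cap 3; cap 2] by (nested_cups x) at 0 0.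
to [:: cup 0; cup 1; cross 2 x; cross 0 x; cap 3; cap 2]
  by (exch (Cross x) (Cross x) 0) at 2 0.
to [:: cup 0; cup 1; cross 0 x; cross 0 x; cap 3; cap 2] by (nested_cups x) at 0 0.
to [:: cup 0; cup 1; cross 0 x; cap 3; cross 0 x; cap 2]
  by (exch (Cross x) Cap 1) at 3 0.
to [:: cup 0; cup 1; cross 0 x; cap 3; cap 2; cross 0 x]
  by (exch (Cross x) Cap 0) at 4 0.
to [:: cup 0; cup 1; cap 3; cross 0 x; cap 2; cross 0 x]
  by (exch (Cross x) Cap 1) at 2 0.
to [:: cup 0; cup 1; cap 3; cap 2; cross 0 x; cross 0 x]
  by (exch (Cross x) Cap 0) at 3 0.
to [:: cross 0 x; cross 0 x] by nested_zigzag at 0 0.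
exact: equiv_refl.
Qed.

(** * The 4-move from two wink-moves *)

Lemma four_equiv : equiv 2 [:: under 0; under 0] [:: over 0; over 0].
Proof.
(* The lower virtual crossing serves both wink-moves; the upper one is kept to cancel it
   afterwards. *)
to [:: under 0; under 0; virt 0; virt 0] by (rev (virtual_equiv VR2)) at 2 0.
to [:: cup 1; over 0; virt 1; under 2; cap 1; virt 0] by clasp_wink_lower at 0 0.
(* Sliding the two outer crossings past the extrema is a quarter turn of the three crossings. It
   prepares the second wink-move, whose loop lies on the other strand. *)
to [:: cup 0; under 1; virt 1; under 2; cap 1; virt 0]
  by (rev (cup_turn (Classical false))) at 0 0.
to [:: cup 0; under 1; virt 1; over 1; cap 2; virt 0]
  by (rev (cap_turn (Classical true))) at 3 1.
to [:: cup 0; cup 2; virt 1; over 2; under 3; cap 2; cap 2; virt 0]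
  by clasp_wink_upper at 1 1.
(* From here the upper virtual crossing moves down and the lower one around the minima, until they
   are adjacent and cancel. *)
to [:: cup 0; cup 2; virt 1; over 2; under 3; cap 2; virt 0; cap 2]
  by (rev (exch (Cross Virtual) Cap 0)) at 6 0.
to [:: cup 0; cup 2; virt 1; over 2; under 3; virt 0; cap 2; cap 2]
  by (rev (exch (Cross Virtual) Cap 0)) at 5 0.
to [:: cup 0; cup 2; virt 1; over 2; virt 0; under 3; cap 2; cap 2]
  by (rev (exch (Cross Virtual) (Cross (Classical false)) 1)) at 4 0.
to [:: cup 0; cup 2; virt 1; virt 0; over 2; under 3; cap 2; cap 2]
  by (rev (exch (Cross Virtual) (Cross (Classical true)) 0)) at 3 0.
to [:: cup 0; cup 1; virt 2; virt 0; over 2; under 3; cap 2; cap 2]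
  by (rev (cup_turn Virtual)) at 1 1.
to [:: cup 0; cup 1; virt 0; virt 0; over 2; under 3; cap 2; cap 2]
  by (nested_cups Virtual) at 0 0.
to [:: cup 0; cup 1; over 2; under 3; cap 2; cap 2] by (virtual_equiv VR2) at 2 0.
(* Both classical crossings are now reversed; only a half turn of the picture remains to be
   undone. *)
to [:: cup 0; cup 1; over 2; over 2; cap 3; cap 2]
  by (rev (cap_turn (Classical true))) at 3 2.
exact: half_turn.
Qed.

Theorem proposition1p3 (m n : nat) (D D' : diagram m n)
  (hD : classical D) (hD' : classical D') (h : four_equivalent D D') :
  wink_equivalent D D'.
Proof.
elim: h => {hD hD' D D'} [D D' []|D|D D' _|D E D' _ hDE _ hED'].
- move=> b a P Q i k l [hM|hM] hb hl eqD eqD'.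
    by apply: rst_step; apply: Step hb hl eqD eqD'; left; left.
  case: hM hl eqD eqD' => hl eqD eqD'.
  by have [_ heq] := equiv_sym four_equiv; apply: heq hb hl eqD eqD'.
- exact: rst_refl.
- exact: rst_sym.
- exact: rst_trans hDE hED'.
Qed.
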